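(* Let $\mathcal{C}\subseteq\mathbb{F}(\!(D)\!)^n$ be an $(n,k,\delta)$-code. Then $\mathcal{C}$ has a maximum distance profile if and only if the dual code $\mathcal{C}^{\perp}\subseteq\mathbb{F}(\!(D)\!)^n$ has a maximum distance profile.
   Context: Let $\mathbb{F}$ be a finite field, $\mathbb{F}[D]$ the polynomial ring and $\mathbb{F}(\!(D)\!)$ the field of formal Laurent series $\sum_{j\ge l}a_jD^j$. For $1\le k<n$, a convolutional code of rate $k/n$ is a set $\mathcal{C}=\{uG\mid u\in\mathbb{F}(\!(D)\!)^k\}\subseteq\mathbb{F}(\!(D)\!)^n$ with $G\in\mathbb{F}[D]^{k\times n}$ of rank $k$; $G$ is called a generator matrix of $\mathcal{C}$. A polynomial matrix is basic if it has a polynomial right inverse; a polynomial generator matrix is minimal if the sum of its row degrees is minimal among all polynomial generator matrices of $\mathcal{C}$. Every code has a generator matrix that is both minimal and basic, and the degree $\delta$ of $\mathcal{C}$ is the sum of the row degrees of such a matrix. A code of rate $k/n$ and degree $\delta$ is called an $(n,k,\delta)$-code. The dual code is $\mathcal{C}^\perp=\{w\in\mathbb{F}(\!(D)\!)^n\mid wv^{\mathsf T}=0\text{ for all }v\in\mathcal{C}\}$; it is an $(n,n-k,\delta)$-code. For $w\in\mathbb{F}^N$, $\mathrm{wt}(w)$ is the number of nonzero coordinates. For $v=\sum_j v_jD^j\in\mathbb{F}(\!(D)\!)^n\setminus\{0\}$ the delay of $v$ is $\min\{j\mid v_j\ne0\}$, and $v_{[m,M]}:=(v_m,\dots,v_M)$.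 For $j\ge 0$ the $j$th column distance of a code $\mathcal{C}$ is $d^c_j:=\min\{\mathrm{wt}(v_{[0,j]})\mid v\in\mathcal{C},\ \text{delay of }v\text{ equals }0\}$. An $(n,k,\delta)$-code has a maximum distance profile if $d^c_j=(n-k)(j+1)+1$ for all $j=0,\dots,L$, where $L:=\lfloor\frac{\delta}{k}\rfloor+\lfloor\frac{\delta}{n-k}\rfloor$. (For the dual code the roles of $k$ and $n-k$ are interchanged and $L$ is the same.) *)

(* Defs.v *)
From HB Require Import structures.
From mathcomp Require Import all_boot all_order all_algebra.
From mathcomp Require Import boolp classical_sets fsbigop.
From mathcomp Require Import zify.

Set Implicit Arguments.
Unset Strict Implicit.
Unset Printing Implicit Defensive.

Import Order.TTheory GRing.Theory Num.Theory.
Local Open Scope ring_scope.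

(** * The field F((D)) of formal Laurent series *)

(* \sum_(j >= l) a_j D^j is represented by its coefficient function
   j |-> a_j on int, which vanishes below some l.                             *)
Record laurent (F : fieldType) := Laurent {
  lcoef :> int -> F;
  lcoef_bounded : exists l : int, forall j, j < l -> lcoef j = 0
}.

HB.instance Definition _ (F : fieldType) := gen_eqMixin (laurent F).
HB.instance Definition _ (F : fieldType) := gen_choiceMixin (laurent F).

Section LaurentField.
Variable F : fieldType.
Implicit Types a b c : laurent F.

Lemma laurentP a b : (forall j, a j = b j) -> a = b.
Proof.
case: a b => [f hf] [g hg] /= /funext fg; move: hf hg; rewrite fg => hf hg.
by congr Laurent; apply: Prop_irrelevance.
Qed.

Definition vanish_below (l : int) (f : int -> F) := forall j, j < l -> f j = 0.

Fact laurent_zero_bounded : exists l, vanish_below l (fun=> 0).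
Proof. by exists 0. Qed.
Definition laurent_zero := Laurent laurent_zero_bounded.

Fact laurent_one_bounded : exists l, vanish_below l (fun j => (j == 0)%:R).
Proof. by exists 0 => j; case: eqP => // ->. Qed.
Definition laurent_one := Laurent laurent_one_bounded.

Fact laurent_opp_bounded a : exists l, vanish_below l (fun j => - a j).
Proof. by have [l al] := lcoef_bounded a; exists l => j /al ->; rewrite oppr0. Qed.
Definition laurent_opp a := Laurent (laurent_opp_bounded a).

Fact laurent_add_bounded a b : exists l, vanish_below l (fun j => a j + b j).
Proof.
have [l al] := lcoef_bounded a; have [m bm] := lcoef_bounded b.
exists (Num.min l m) => j; rewrite lt_min => /andP[jl jm].
by rewrite al ?bm ?addr0.
Qed.
Definition laurent_add a b := Laurent (laurent_add_bounded a b).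

Fact laurent_addA : associative laurent_add.
Proof. by move=> a b c; apply: laurentP => j /=; rewrite addrA. Qed.
Fact laurent_addC : commutative laurent_add.
Proof. by move=> a b; apply: laurentP => j /=; rewrite addrC. Qed.
Fact laurent_add0 : left_id laurent_zero laurent_add.
Proof. by move=> a; apply: laurentP => j /=; rewrite add0r. Qed.
Fact laurent_addN : left_inverse laurent_zero laurent_opp laurent_add.
Proof. by move=> a; apply: laurentP => j /=; rewrite addNr. Qed.

HB.instance Definition _ := GRing.isZmodule.Build (laurent F)
  laurent_addA laurent_addC laurent_add0 laurent_addN.

(* Cauchy product; the sum has finite support because both factors are
   bounded below.                                                             *)
Definition conv (f g : int -> F) (j : int) : F :=
  \sum_(i \in [set: int]) f i * g (j - i).

Lemma convE f g l m (N : nat) (j : int) :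
    vanish_below l f -> vanish_below m g -> j - l - m < N%:Z ->
  conv f g j = \sum_(i < N) f (l + i%:Z) * g (j - (l + i%:Z)).
Proof.
move=> fl gm jN; pose r := [seq l + i%:Z | i <- iota 0 N].
rewrite /conv (fsbigE r) //=; first last.
- move=> i _ ir; have [/fl->|li] := ltP i l; first by rewrite mul0r.
  have -> : g (j - i) = 0; last by rewrite mulr0.
  apply: gm; rewrite ltNge; apply: contra ir => mi.
  by apply/mapP; exists (absz (i - l)%R); rewrite ?mem_iota; lia.
- by rewrite map_inj_uniq ?iota_uniq // => x y; lia.
rewrite (eq_bigl xpredT); last by move=> i; rewrite in_setT.
by rewrite big_map -{1}(subn0 N) -/(index_iota 0 N) big_mkord.
Qed.

Lemma conv_vanish f g l m :
  vanish_below l f -> vanish_below m g -> vanish_below (l + m) (conv f g).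
Proof.
by move=> fl gm j jlm; rewrite (@convE _ _ l m 0) ?big_ord0 //; lia.
Qed.

Fact laurent_mul_bounded a b : exists l, vanish_below l (conv a b).
Proof.
have [l al] := lcoef_bounded a; have [m bm] := lcoef_bounded b.
by exists (l + m); apply: conv_vanish.
Qed.
Definition laurent_mul a b := Laurent (laurent_mul_bounded a b).

(* A product of Laurent series agrees, up to any given order, with a product
   of polynomials.                                                            *)
Definition trunc (l : int) (N : nat) (f : int -> F) : {poly F} :=
  \poly_(i < N) f (l + i%:Z).

Lemma coef_trunc l N f i : (i < N)%N -> (trunc l N f)`_i = f (l + i%:Z).
Proof. by move=> iN; rewrite coef_poly iN. Qed.

Lemma conv_trunc f g l m (N k : nat) :
    vanish_below l f -> vanish_below m g -> (k < N)%N ->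
  conv f g (l + m + k%:Z) = (trunc l N f * trunc m N g)`_k.
Proof.
move=> fl gm kN; rewrite (@convE _ _ l m k.+1) //; last by lia.
rewrite coefM; apply: eq_bigr => i _.
have ik : (i <= k)%N by rewrite -ltnS.
rewrite !coef_trunc ?(leq_ltn_trans ik) ?(leq_ltn_trans (leq_subr _ _)) //.
by congr (_ * g _); lia.
Qed.

Lemma coefM_eq (p q p' q' : {poly F}) (k : nat) :
    (forall i, (i <= k)%N -> p`_i = p'`_i) ->
    (forall i, (i <= k)%N -> q`_i = q'`_i) ->
  (p * q)`_k = (p' * q')`_k.
Proof.
move=> pp qq; rewrite !coefM; apply: eq_bigr => i _.
by rewrite pp ?qq ?leq_subr // -ltnS.
Qed.

Fact laurent_mulA : associative laurent_mul.
Proof.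
move=> a b c; apply: laurentP => j /=.
have [l al] := lcoef_bounded a; have [m bm] := lcoef_bounded b.
have [n cn] := lcoef_bounded c.
have abv := conv_vanish al bm; have bcv := conv_vanish bm cn.
have [jlt|jge] := ltP j (l + m + n).
  by rewrite (conv_vanish abv cn) // (conv_vanish al bcv) // addrA.
pose k := absz (j - (l + m + n))%R.
have -> : j = l + (m + n) + k%:Z by rewrite /k; lia.
rewrite (conv_trunc al bcv (ltnSn k)) addrA (conv_trunc abv cn (ltnSn k)).
transitivity ((trunc l k.+1 a * (trunc m k.+1 b * trunc n k.+1 c))`_k).
  by apply: coefM_eq => // i ik; rewrite coef_trunc // (@conv_trunc _ _ _ _ k.+1).
rewrite mulrA; apply: coefM_eq => // i ik.
by rewrite coef_trunc // (@conv_trunc _ _ _ _ k.+1).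
Qed.

Fact laurent_mulC : commutative laurent_mul.
Proof.
move=> a b; apply: laurentP => j /=.
have [l al] := lcoef_bounded a; have [m bm] := lcoef_bounded b.
have [jlt|jge] := ltP j (l + m).
  by rewrite (conv_vanish al bm) // (conv_vanish bm al) // addrC.
pose k := absz (j - (l + m))%R; have -> : j = l + m + k%:Z by rewrite /k; lia.
rewrite (conv_trunc al bm (ltnSn k)) [l + m]addrC.
by rewrite (conv_trunc bm al (ltnSn k)) mulrC.
Qed.

Fact laurent_mul1 : left_id laurent_one laurent_mul.
Proof.
move=> a; apply: laurentP => j /=.
have [l al] := lcoef_bounded a.
pose N := (absz (j - l)%R).+1.
rewrite (@convE _ _ 0 l N) //; first last.
- by rewrite /N; lia.
- by move=> i; case: eqP => // ->.
rewrite big_ord_recl /= mul1r big1 ?addr0 ?subr0 // => i _.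
by rewrite mul0r.
Qed.

Fact laurent_mulDl : left_distributive laurent_mul laurent_add.
Proof.
move=> a b c; apply: laurentP => j /=.
have [l al] := lcoef_bounded a; have [m bm] := lcoef_bounded b.
have [n cn] := lcoef_bounded c.
pose s := Num.min l m; pose N := (absz (j - s - n)%R).+1.
have vs (f : int -> F) t : vanish_below t f -> s <= t -> vanish_below s f.
  by move=> ft st i si; apply: ft; exact: lt_le_trans si st.
have as_ : vanish_below s a by apply: vs al _; rewrite /s ge_min lexx.
have bs : vanish_below s b by apply: vs bm _; rewrite /s ge_min lexx orbT.
have jN : j - s - n < N%:Z by rewrite /N; lia.
rewrite (convE (N := N) as_ cn) // (convE (N := N) bs cn) //.
rewrite (@convE _ _ s n N) // => [|i si]; last by rewrite as_ ?bs ?addr0.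
by rewrite -big_split; apply: eq_bigr => i _; rewrite mulrDl.
Qed.

Fact laurent_oner_neq0 : laurent_one != 0.
Proof.
by apply/eqP => /(congr1 (fun a : laurent F => a 0)) /= /eqP; rewrite oner_eq0.
Qed.

HB.instance Definition _ := GRing.Zmodule_isComNzRing.Build (laurent F)
  laurent_mulA laurent_mulC laurent_mul1 laurent_mulDl laurent_oner_neq0.

(* Coefficients of the inverse of a power series with invertible constant
   term, by recursion on the order.                                           *)
Fixpoint inv_seq (f : nat -> F) (N : nat) : seq F :=
  if N isn't N'.+1 then [:: (f 0%N)^-1] else
  let s := inv_seq f N' in
  rcons s (- (f 0%N)^-1 * \sum_(i < N) f i.+1 * s`_(N' - i)).

Lemma size_inv_seq f N : size (inv_seq f N) = N.+1.
Proof. by elim: N => //= N IH; rewrite size_rcons IH. Qed.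

Lemma nth_inv_seq f N i : (i <= N)%N -> (inv_seq f N)`_i = (inv_seq f i)`_i.
Proof.
elim: N => [|N IH]; first by rewrite leqn0 => /eqP->.
rewrite leq_eqVlt => /orP[/eqP->//|iN]; rewrite -IH //=.
by rewrite nth_rcons size_inv_seq iN.
Qed.

Lemma inv_seqP f k : f 0%N != 0 ->
  \sum_(i < k.+1) f i * (inv_seq f (k - i))`_(k - i) = (k == 0%N)%:R.
Proof.
move=> f0; rewrite big_ord_recl subn0; case: k => [|k].
  by rewrite big_ord0 addr0 /= mulfV.
rewrite /= nth_rcons size_inv_seq ltnn eqxx mulrA mulrN mulfV // mulN1r.
apply/eqP; rewrite addrC subr_eq0; apply/eqP/eq_bigr => i _.
by rewrite subSS; congr (_ * _); rewrite (nth_inv_seq _ (leq_subr _ _)).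
Qed.

Lemma laurent_delay a : a != 0 -> exists2 l, a l != 0 & vanish_below l a.
Proof.
move=> a0; have [l al] := lcoef_bounded a.
have [i ai] : exists i, a i != 0.
  apply: contrapT => /forallNP h; case/eqP: a0; apply: laurentP => i /=.
  by apply/eqP; apply: contrapT => /negP; apply: h.
have li : l <= i by rewrite leNgt; apply: contra ai => /al ->.
have ex : exists k : nat, a (l + k%:Z) != 0.
  by exists (absz (i - l)%R); have -> : l + (absz (i - l)%R)%:Z = i by lia.
case: (ex_minnP ex) => k ak kmin; exists (l + k%:Z) => // j jk.
have [/al//|lj] := ltP j l; apply/eqP; apply: contraTT jk => aj.
have -> : j = l + (absz (j - l)%R)%:Z by lia.
have: (k <= absz (j - l)%R)%N.
  by apply: kmin; have -> : l + (absz (j - l)%R)%:Z = j by lia.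
lia.
Qed.

Fact laurent_inv_ex a : a != 0 -> exists b, a * b = 1.
Proof.
move=> /laurent_delay[l al0 al]; pose f i := a (l + i%:Z).
have f0 : f 0%N != 0 by rewrite /f addr0.
pose g (j : int) := if j < - l then 0 else
  let k := absz (j + l)%R in (inv_seq f k)`_k.
have gl : vanish_below (- l) g by move=> j jl; rewrite /g jl.
exists (Laurent (ex_intro _ (- l) gl)); apply: laurentP => j /=.
have [jneg|jpos] := ltP j 0.
  rewrite (conv_vanish al gl) ?subrr //.
  by case: eqP => // j0; rewrite j0 in jneg.
case: j jpos => // k _; rewrite (convE (N := k.+1) al gl); last by lia.
rewrite [RHS](_ : _ = (k == 0%N)%:R) // -(inv_seqP k f0).
apply: eq_bigr => i _; rewrite /f /g ifF; last by have := ltn_ord i; lia.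
by congr (_ * _); have -> : absz (k%:Z - (l + i%:Z) + l)%R = (k - i)%N
  by have := ltn_ord i; lia.
Qed.

Definition laurent_inv a : laurent F := xget 0 [set b | a * b = 1].

Fact laurent_mulVf a : a != 0 -> laurent_inv a * a = 1.
Proof. by move=> /laurent_inv_ex ex; rewrite mulrC; exact: (xgetPex 0 ex). Qed.

Fact laurent_inv0 : laurent_inv 0 = 0.
Proof.
apply: xgetPN => b /= /eqP; rewrite mul0r eq_sym; exact/negP/oner_neq0.
Qed.

HB.instance Definition _ :=
  GRing.ComNzRing_isField.Build (laurent F) laurent_mulVf laurent_inv0.

End LaurentField.

(* The inclusion of F[D] in F((D)). *)
Definition poly_coef (F : fieldType) (p : {poly F}) (j : int) : F :=
  if j is Posz i then p`_i else 0.

Fact poly_laurent_bounded (F : fieldType) (p : {poly F}) :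
  exists l, vanish_below l (poly_coef p).
Proof. by exists 0; case. Qed.

Definition poly_laurent (F : fieldType) (p : {poly F}) : laurent F :=
  Laurent (poly_laurent_bounded p).

(** * Convolutional codes *)

Local Open Scope classical_set_scope.

Section Codes.
Variables (F : fieldType) (n : nat).
Implicit Types C : set 'rV[laurent F]_n.

Definition laurent_mx k (G : 'M[{poly F}]_(k, n)) : 'M[laurent F]_(k, n) :=
  map_mx (@poly_laurent F) G.

Definition generator_matrix k (G : 'M[{poly F}]_(k, n)) C : Prop :=
  \rank (laurent_mx G) = k /\
  C = [set v | exists u : 'rV[laurent F]_k, v = u *m laurent_mx G].

Definition basic k (G : 'M[{poly F}]_(k, n)) : Prop :=
  exists H : 'M[{poly F}]_(n, k), G *m H = 1%:M.

(* The zero entries count as degree 0; a matrix of full row rank has no zero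
   row, so this is harmless for generator matrices.                           *)
Definition row_degree k (G : 'M[{poly F}]_(k, n)) (i : 'I_k) : nat :=
  \max_(j < n) (size (G i j)).-1.

Definition row_degree_sum k (G : 'M[{poly F}]_(k, n)) : nat :=
  \sum_(i < k) row_degree G i.

Definition minimal_generator k (G : 'M[{poly F}]_(k, n)) C : Prop :=
  generator_matrix G C /\
  forall G' : 'M[{poly F}]_(k, n), generator_matrix G' C ->
    (row_degree_sum G <= row_degree_sum G')%N.

(* C is an (n, k, delta)-code. *)
Definition conv_code (k delta : nat) C : Prop :=
  [/\ (1 <= k)%N, (k < n)%N &
      exists G : 'M[{poly F}]_(k, n),
        [/\ minimal_generator G C, basic G & row_degree_sum G = delta]].

Definition dual_code C : set 'rV[laurent F]_n :=
  [set w | forall v, C v -> w *m v^T = 0].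

Definition weight N (w : 'rV[F]_N) : nat := #|[pred i | w 0 i != 0]|.

(* The coefficient v_j in F^n of v = \sum_j v_j D^j. *)
Definition vcoef (v : 'rV[laurent F]_n) (j : int) : 'rV[F]_n :=
  \row_i (v 0 i) j.

Definition has_delay (v : 'rV[laurent F]_n) (d : int) : Prop :=
  vcoef v d != 0 /\ forall j, j < d -> vcoef v j = 0.

(* v_[0,j] = (v_0, ..., v_j), concatenated into a vector of length (j+1) n. *)
Definition window (v : 'rV[laurent F]_n) (j : nat) : 'rV[F]_(j.+1 * n) :=
  mxvec (\matrix_(t < j.+1) vcoef v t%:Z).

Definition nat_min (A : set nat) : nat :=
  xget 0%N [set m | A m /\ lbound A m].

(* The minimum is over a nonempty set as soon as C is nonzero. *)
Definition column_distance C (j : nat) : nat :=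
  nat_min [set weight (window v j) | v in [set v | C v /\ has_delay v 0]].

(* A maximum distance profile is a property of (n, k, delta)-codes, so
   membership in that class is part of the predicate.                         *)
Definition max_distance_profile (k delta : nat) C : Prop :=
  conv_code k delta C /\
  forall j : nat, (j <= delta %/ k + delta %/ (n - k))%N ->
    column_distance C j = ((n - k) * j.+1 + 1)%N.

End Codes.

(* Main.v *)
(* Degree of the dual. If G is a basic generator matrix with right inverse R,
   then I - RG projects onto the orthogonal of G; this makes a minimal generator
   matrix H of the dual basic. Comparing, for large d, the number n(d+1) of
   coefficients of a polynomial vector v of degree at most d with the number of
   coefficients of v H^T, and of u when v = uG, yields deg G <= deg H, and
   equality by symmetry.

   Distance profile. Let w be a dual word of delay 0 with at most k(j+1) nonzero
   coordinates in its window, j minimal. Reversed in time, w is a linear relation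
   between coordinates, indexed by a set T, of the windows of C. Enlarge T to a
   set U of k(j+1) coordinates and take a nonzero window of C vanishing on U but
   for one element in the support of w at the last time; by the relation it
   vanishes there too. If it starts at time i, then by minimality of j it has at
   least k(j-i+1) zeros from time i on, against the distance profile of C.       *)

Require Import Defs.
From HB Require Import structures.
From mathcomp Require Import all_boot all_order all_algebra.
From mathcomp Require Import boolp classical_sets.
From mathcomp Require Import zify.
Set Implicit Arguments.
Unset Strict Implicit.
Unset Printing Implicit Defensive.
Import Order.TTheory GRing.Theory Num.Theory.
Local Open Scope ring_scope.

(** * Laurent series of polynomials *)

Section PolyLaurent.
Variable F : fieldType.

Fact poly_laurent_is_zmod_morphism : zmod_morphism (@poly_laurent F).
Proof. by move=> p q; apply: laurentP => -[i|i] /=; rewrite ?coefB ?subr0. Qed.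

Fact poly_laurent_is_monoid_morphism : monoid_morphism (@poly_laurent F).
Proof.
split=> [|p q]; apply: laurentP => -[i|i] //=; first by rewrite coef1.
  rewrite (@convE _ _ _ 0 0 i.+1) //; try by [case|lia].
  rewrite coefM; apply: eq_bigr => t _; rewrite add0r /=; congr (_ * _).
  by have -> : Posz i - Posz t = Posz (i - t) by have := ltn_ord t; lia.
by symmetry; apply: (@conv_vanish _ _ _ 0 0) => //; case.
Qed.

HB.instance Definition _ := GRing.isZmodMorphism.Build {poly F} (laurent F)
  (@poly_laurent F) poly_laurent_is_zmod_morphism.
HB.instance Definition _ := GRing.isMonoidMorphism.Build {poly F} (laurent F)
  (@poly_laurent F) poly_laurent_is_monoid_morphism.

Lemma poly_laurent_inj : injective (@poly_laurent F).
Proof.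
move=> p q pq; apply/polyP => i.
by have := congr1 (fun a : laurent F => a i%:Z) pq.
Qed.

Lemma coef_laurentXnM (a : laurent F) (i : nat) (j : int) :
  (poly_laurent 'X^i * a) j = a (j - i%:Z).
Proof.
have [l al] := lcoef_bounded a.
(* The number of terms exceeds [j - l], as [convE] requires, and also [i], so that the only nonzero
   term is in range. *)
rewrite [LHS](@convE _ _ _ 0 l ((absz (j - l)%R).+1 + i.+1)%N) //; try by [case|lia].
have hi : (i < (absz (j - l)%R).+1 + i.+1)%N by lia.
rewrite (bigD1 (Ordinal hi)) //= add0r coefXn eqxx mul1r big1 ?addr0 // => t ti.
by rewrite add0r /= coefXn -[_ == i]/(t == Ordinal hi) (negPf ti) mul0r.
Qed.
End PolyLaurent.

(** * Minimal generator matrices *)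

Section Generators.
Variables (F : fieldType) (n : nat).
Implicit Types C : set 'rV[laurent F]_n.

Lemma map_poly_laurent_inj m p : injective (@laurent_mx F p m).
Proof.
move=> A B /matrixP AB; apply/matrixP => i j; apply: poly_laurent_inj.
by have := AB i j; rewrite !mxE.
Qed.

Lemma generator_free k (G : 'M[{poly F}]_(k, n)) C :
  generator_matrix G C -> row_free (laurent_mx G).
Proof. by case=> rG _; rewrite /row_free rG. Qed.

Lemma mem_generator k (G : 'M[{poly F}]_(k, n)) C v :
  generator_matrix G C -> C v <-> (v <= laurent_mx G)%MS.
Proof.
move=> [_ ->] /=; split=> [[u ->]|/submxP[u ->]]; first exact: submxMl.
by exists u.
Qed.

Lemma mem_dual k (G : 'M[{poly F}]_(k, n)) C w :
  generator_matrix G C -> dual_code C w <-> w *m (laurent_mx G)^T = 0.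
Proof.
move=> genG; split=> [dw|wG v /(mem_generator _ genG)/submxP[u ->]].
  apply: trmx_inj; rewrite trmx_mul trmxK trmx0; apply/row_matrixP => i.
  rewrite row_mul row0; apply: trmx_inj; rewrite trmx_mul trmxK trmx0.
  by apply: dw; apply/(mem_generator _ genG)/row_sub.
by rewrite trmx_mul mulmxA wG mul0mx.
Qed.

Lemma cancel_poly_free m k (H : 'M[{poly F}]_(k, n)) (A B : 'M[{poly F}]_(m, k)) :
  row_free (laurent_mx H) -> A *m H = B *m H -> A = B.
Proof.
move=> fH AB; apply: map_poly_laurent_inj; apply: (row_free_inj fH).
by rewrite /laurent_mx -!map_mxM AB.
Qed.

(** Since [c 0 i] is invertible, [w] can replace row [i] of [G] without changing the code, and by
    minimality this cannot lower the degree of the row. *)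
Lemma minimal_exchange k (G : 'M[{poly F}]_(k, n)) C (w : 'rV[{poly F}]_n)
    (c : 'rV[laurent F]_k) i :
    minimal_generator G C -> laurent_mx w = c *m laurent_mx G -> c 0 i != 0 ->
  exists j, (row_degree G i < size (w 0%R j))%N.
Proof.
move=> [genG minG] wE ci; apply: contrapT => /forallNP small.
have {}small j : (size (w 0%R j) <= row_degree G i)%N.
  by rewrite leqNgt; apply/negP/small.
pose G' : 'M_(k, n) := \matrix_(l < k) if l == i then w else row l G.
have rowG' l : row l (laurent_mx G') =
    if l == i then c *m laurent_mx G else row l (laurent_mx G).
  rewrite -map_row rowK; case: eqP => // _; by rewrite map_row.
have wsum : c *m laurent_mx G = c 0 i *: row i (laurent_mx G) +
    \sum_(l < k | l != i) c 0 l *: row l (laurent_mx G').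
  rewrite mulmx_sum_row (bigD1 i) //=; congr (_ + _).
  by apply: eq_bigr => l li; rewrite rowG' (negPf li).
have subG' : (laurent_mx G <= laurent_mx G')%MS.
  apply/row_subP => l; have [->|li] := eqVneq l i; last first.
    by have := rowG' l; rewrite (negPf li) => <-; apply: row_sub.
  have -> : row i (laurent_mx G) = (c 0 i)^-1 *: (row i (laurent_mx G') -
      \sum_(l < k | l != i) c 0 l *: row l (laurent_mx G')).
    by rewrite rowG' eqxx wsum addrK scalerA mulVf // scale1r.
  apply/scalemx_sub/addmx_sub; first exact: row_sub.
  by rewrite eqmx_opp; apply: summx_sub => l' _; apply/scalemx_sub/row_sub.
have subG : (laurent_mx G' <= laurent_mx G)%MS.
  apply/row_subP => l; rewrite rowG'; case: eqP => _; last exact: row_sub.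
  exact: submxMl.
have genG' : generator_matrix G' C.
  case: genG => rG CE; split.
    by apply/eqP; rewrite eqn_leq rank_leq_row -{1}rG mxrankS.
  rewrite CE; apply/predeqP => v /=; split=> -[u ->].
    by apply/submxP/(submx_trans _ subG')/submxMl.
  by apply/submxP/(submx_trans _ subG)/submxMl.
have := minG _ genG'; rewrite leqNgt => /negP; apply.
rewrite /row_degree_sum (bigD1 i) //= [X in (_ < X)%N](bigD1 i) //=.
rewrite -addSn leq_add //; last first.
  apply: leq_sum => l li; rewrite /row_degree; apply/eq_leq/eq_bigr => j _.
  by rewrite mxE (negPf li) mxE.
have [j wj] : exists j, w 0 j != 0.
  apply: contrapT => /forallNP w0; case/negP: ci; apply/eqP.
  suff -> : c = 0 by rewrite mxE.
  apply: (row_free_inj (generator_free genG)); rewrite -wE mul0mx.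
  apply/rowP => j; rewrite !mxE; have /negP/negPn/eqP -> := w0 j; exact: rmorph0.
(* Row degrees use a truncated predecessor, so a strict drop needs a positive [row_degree G i]; the
   nonzero entry of [w] provides it. *)
have pos : (0 < row_degree G i)%N.
  by apply: leq_trans (small j); rewrite size_poly_gt0.
rewrite [X in (X < _)%N]/row_degree -(prednK pos) ltnS; apply/bigmax_leqP => l _.
by rewrite mxE eqxx; have := small l; lia.
Qed.

Lemma size_polyM_pred (p q : {poly F}) m :
  p != 0 -> ((size q).-1 <= m)%N -> (size (p * q)%R <= size p + m)%N.
Proof.
rewrite -size_poly_gt0 => p0 qm; have := size_polyMleq p q; lia.
Qed.

Lemma size_polyM_leq (p q : {poly F}) m : p != 0 ->
  (size (p * q)%R <= (size p).-1 + m)%N -> (size q <= m)%N.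
Proof.
move=> p0; have [->|q0] := eqVneq q 0; first by rewrite size_poly0.
have -> : size (p * q)%R = (size p + size q).-1 by exact: size_mul.
by move: p0; rewrite -size_poly_gt0; lia.
Qed.

Lemma size_mulmx_row k (G : 'M[{poly F}]_(k, n)) (r : 'rV[{poly F}]_k) b j :
    (forall l, r 0 l != 0 -> (size (r 0%R l) + row_degree G l <= b)%N) ->
  (size ((r *m G) 0%R j) <= b)%N.
Proof.
move=> rb; rewrite mxE (leq_trans (size_sum _ _ _)) //; apply/bigmax_leqP => l _.
have [->|rl] := eqVneq (r 0 l) 0; first by rewrite mul0r size_poly0.
apply: leq_trans (rb l rl); apply: size_polyM_pred => //.
exact: (leq_bigmax j).
Qed.

(** Cramer's rule for an invertible square submatrix [S] of [G]: its determinant is the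
    denominator. *)
Lemma common_denominator k (G : 'M[{poly F}]_(k, n)) (w : 'rV[{poly F}]_n) x :
    row_free (laurent_mx G) -> laurent_mx w = x *m laurent_mx G ->
  exists2 q : {poly F}, q != 0 &
    exists y : 'rV[{poly F}]_k, poly_laurent q *: x = laurent_mx y.
Proof.
move=> fG wE.
have full : row_full (laurent_mx G)^T by rewrite /row_full mxrank_tr.
pose S := colsub (fullrankfun full) G.
have SE : laurent_mx S = (rowsub (fullrankfun full) (laurent_mx G)^T)^T.
  by apply/matrixP => a b; rewrite !mxE.
exists (\det S).
  rewrite -(inj_eq (@poly_laurent_inj F)) -det_map_mx rmorph0.
  by rewrite -unitfE -unitmxE [map_mx _ _]SE unitmx_tr fullrowsub_unit.
exists (colsub (fullrankfun full) w *m \adj S).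
rewrite /laurent_mx map_mxM map_mx_adj -mul_mx_scalar -det_map_mx -mul_mx_adj mulmxA.
congr (_ *m _); apply/rowP => b.
move/rowP/(_ (fullrankfun full b)): wE; rewrite !mxE => wb.
by rewrite [RHS]wb; apply: eq_bigr => a _; rewrite !mxE.
Qed.

(** Dividing the numerators of the coefficients by a common denominator [q] leaves [w'] with
    [q *: w' = r *m G] and remainders [r] of degree below that of [q]. Unless [r] vanishes, the
    degree of [w'] is too small for [minimal_exchange]. *)
Lemma minimal_saturated k (G : 'M[{poly F}]_(k, n)) C (w : 'rV[{poly F}]_n) :
    minimal_generator G C -> C (laurent_mx w) ->
  exists u : 'rV[{poly F}]_k, w = u *m G.
Proof.
move=> minG; have [genG _] := minG; have fG := generator_free genG.
move=> /(mem_generator _ genG)/submxP[x wE].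
have [q q0 [y yE]] := common_denominator fG wE.
pose u := map_mx (fun p => p %/ q) y; pose r := map_mx (fun p => p %% q) y.
have yur : y = q *: u + r.
  by apply/rowP => l; rewrite !mxE mulrC -divp_eq.
exists u; apply/eqP; rewrite -subr_eq0; apply/eqP; set w' := w - _.
have cE : laurent_mx w' = (x - laurent_mx u) *m laurent_mx G.
  by rewrite /laurent_mx map_mxB map_mxM mulmxBl -[map_mx _ w]/(laurent_mx w) wE.
have rE : poly_laurent q *: (x - laurent_mx u) = laurent_mx r.
  by rewrite scalerBr yE yur /laurent_mx map_mxD map_mxZ addrC addKr.
have rw' : q *: w' = r *m G.
  apply: map_poly_laurent_inj.
  by rewrite /laurent_mx map_mxM map_mxZ -[map_mx _ r]rE -scalemxAl -cE.
have q0' : poly_laurent q != 0.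
  by rewrite -(rmorph0 (@poly_laurent F)) (inj_eq (@poly_laurent_inj F)).
have [i0 ri0|r0] := pickP (fun i => r 0 i != 0); last first.
  have {}r0 : r = 0 by apply/rowP => l; rewrite [RHS]mxE; apply/eqP/negbFE/r0.
  move: rw'; rewrite r0 mul0mx => /rowP rw'; apply/rowP => j.
  by have /eqP := rw' j; rewrite !mxE mulf_eq0 (negPf q0) => /eqP.
(* Among the rows with nonzero remainder, one of largest degree controls the degree of [r *m G]. *)
case: (@arg_maxnP _ i0 (fun l => r 0 l != 0) (row_degree G) ri0) => i ri imax.
have ci : (x - laurent_mx u) 0 i != 0.
  apply: contraNneq ri => ci; move/rowP/(_ i): rE.
  rewrite mxE ci mulr0 mxE => /esym/eqP.
  by rewrite -(rmorph0 (@poly_laurent F)) (inj_eq (@poly_laurent_inj F)).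
have [j] := minimal_exchange minG cE ci.
rewrite ltnNge => /negP[].
have: (size ((q *: w') 0%R j) <= (size q).-1 + row_degree G i)%N.
  rewrite rw'; apply: size_mulmx_row => l rl; rewrite leq_add //; last exact: imax.
  by rewrite -ltnS prednK ?size_poly_gt0 // mxE ltn_modp.
by rewrite mxE; apply: size_polyM_leq.
Qed.

(* A row i attaining the largest degree of some u_l G_l, with the largest
   row degree among these, could be exchanged for the high-order part of uG
   if leading terms cancelled.                                                *)
Lemma predictable_degree k (G : 'M[{poly F}]_(k, n)) C (u : 'rV[{poly F}]_k) i :
    minimal_generator G C -> u 0 i != 0 ->
  exists j, (size (u 0%R i) + row_degree G i <= size ((u *m G) 0%R j))%N.
Proof.
move=> minG ui.
pose s l := (size (u 0%R l) + row_degree G l)%N.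
case: (@arg_maxnP _ i (fun l => u 0 l != 0) s ui) => i1 ui1 max1.
have Pi1 : (u 0 i1 != 0) && (s i1 == s i1) by rewrite ui1 eqxx.
case: (@arg_maxnP _ i1 (fun l => (u 0 l != 0) && (s l == s i1)) (row_degree G) Pi1).
move=> i2 /andP[ui2 /eqP s2] max2.
suff [j hj] : exists j, (s i2 <= size ((u *m G) 0%R j))%N.
  by exists j; apply: leq_trans hj; rewrite s2; exact: max1.
apply: contrapT => /forallNP small.
pose m := (size (u 0%R i2)).-1.
have sm : size (u 0%R i2) = m.+1 by rewrite prednK // size_poly_gt0.
pose a := map_mx (drop_poly m) u; pose r := map_mx (take_poly m) u.
have uE : u = 'X^m *: a + r.
  by apply/rowP => l; rewrite !mxE addrC mulrC poly_take_drop.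
have ca : laurent_mx (a *m G) = laurent_mx a *m laurent_mx G by exact: map_mxM.
have [|j] := minimal_exchange minG ca (i := i2).
  rewrite mxE -(rmorph0 (@poly_laurent F)) (inj_eq (@poly_laurent_inj F)) mxE.
  by rewrite -size_poly_gt0 size_drop_poly sm subSnn.
rewrite ltnNge => /negP[].
apply: (@size_polyM_leq 'X^m); first by rewrite -size_poly_gt0 size_polyXn.
rewrite size_polyXn /=.
have -> : 'X^m * (a *m G) 0 j = (u *m G) 0 j - (r *m G) 0 j.
  by rewrite uE mulmxDl -scalemxAl !mxE addrK.
rewrite (leq_trans (size_polyD _ _)) // size_polyN geq_max; apply/andP; split.
  by have /negP := small j; rewrite /s sm; lia.
apply: size_mulmx_row => l; rewrite mxE => rl.
have ul : u 0 l != 0.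
  by apply: contraNneq rl => ->; rewrite take_poly0r.
(* If [s l] is below the maximum, truncation only has to preserve the bound; if it attains the
   maximum, the choice of [i2] bounds the row degree and truncation brings the size down to [m]. *)
have sl : (s l <= m.+1 + row_degree G i2)%N by rewrite -sm -/(s i2) s2; exact: max1.
have nl : s l = (m.+1 + row_degree G i2)%N -> (row_degree G l <= row_degree G i2)%N.
  by rewrite -sm -/(s i2) s2 => sE; apply: max2; rewrite ul sE eqxx.
have t1 := size_take_poly m (u 0 l).
have t2 : (size (take_poly m (u 0%R l)) <= size (u 0%R l))%N.
  have [le|lt] := leqP (size (u 0%R l)) m; first by rewrite take_poly_id.
  exact: leq_trans (size_take_poly _ _) (ltnW lt).
by rewrite /s in sl nl; lia.
Qed.

End Generators.

(** * The dual code *)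

Section Dual.
Variables (F : fieldType) (n k : nat) (C : set 'rV[laurent F]_n).
Variables (G : 'M[{poly F}]_(k, n)) (R : 'M[{poly F}]_(n, k)).
Hypotheses (genG : generator_matrix G C) (GR : G *m R = 1%:M).

(** The transpose of I - RG, because it acts on row vectors from the right. *)
Let E := 1%:M - G^T *m R^T.

Let E_orth : E *m G^T = 0.
Proof.
by rewrite mulmxBl mul1mx -mulmxA -trmx_mul GR trmx1 mulmx1 subrr.
Qed.

Let E_proj m (w : 'M_(m, n)) : w *m G^T = 0 -> w *m E = w.
Proof.
by move=> wG; rewrite mulmxBr mulmx1 mulmxA wG mul0mx subr0.
Qed.

(** The rows of [E] are polynomial and span the kernel of the transpose of [G], so [n - k]
    independent rows among them generate the dual. *)
Lemma dual_generator_ex :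
  exists H : 'M[{poly F}]_(n - k, n), generator_matrix H (dual_code C).
Proof.
have rG : \rank (laurent_mx G) = k by case: genG.
have LGt : (laurent_mx G)^T = laurent_mx G^T by rewrite /laurent_mx map_trmx.
have kerE : (kermx (laurent_mx G)^T :=: laurent_mx E)%MS.
  apply/eqmxP/andP; split; last first.
    by apply/sub_kermxP; rewrite LGt /laurent_mx -map_mxM E_orth map_mx0.
  have -> : kermx (laurent_mx G)^T = kermx (laurent_mx G)^T *m laurent_mx E.
    rewrite /E /laurent_mx map_mxB map_mx1 map_mxM -[map_mx _ G^T]LGt.
    by rewrite mulmxBr mulmx1 mulmxA mulmx_ker mul0mx subr0.
  exact: submxMl.
have rE : \rank (laurent_mx E) = (n - k)%N by rewrite -kerE mxrank_ker mxrank_tr rG.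
have [f eqf] : exists f : 'I_(n - k) -> 'I_n,
    (rowsub f (laurent_mx E) :=: laurent_mx E)%MS.
  by rewrite -rE; exists (maxrankfun (laurent_mx E)); apply: eq_maxrowsub.
have fE : laurent_mx (rowsub f E) = rowsub f (laurent_mx E).
  by apply/matrixP => i j; rewrite !mxE.
exists (rowsub f E); split; first by rewrite fE eqf.
apply/predeqP => w; rewrite (mem_dual _ genG) /=.
split=> [/sub_kermxP|[u ->]].
  by rewrite kerE -eqf -fE => /submxP.
by apply/sub_kermxP; rewrite kerE -eqf -fE submxMl.
Qed.

Lemma dual_minimal_ex :
  exists H : 'M[{poly F}]_(n - k, n), minimal_generator H (dual_code C).
Proof.
have [H0 genH0] := dual_generator_ex.
pose P m := `[< exists2 H : 'M[{poly F}]_(n - k, n),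
  generator_matrix H (dual_code C) & row_degree_sum H = m >].
have exP : exists m, P m by exists (row_degree_sum H0); apply/asboolP; exists H0.
case: (ex_minnP exP) => m /asboolP[H genH <-] minm; exists H; split=> // H' genH'.
by apply: minm; apply/asboolP; exists H'.
Qed.

(** The rows of [E] lie in the dual, so saturation gives [E = X *m H]. Then
    [H *m X *m H = H *m E = H], and cancelling [H] makes [X] a right inverse. *)
Lemma dual_minimal_basic k' (H : 'M[{poly F}]_(k', n)) :
  minimal_generator H (dual_code C) -> basic H.
Proof.
move=> minH; have [genH _] := minH.
have memH m (A : 'M_(m, n)) : A *m G^T = 0 -> exists X, A = X *m H.
  move=> AG; have rowA i : exists x, row i A = x *m H.
    apply: (minimal_saturated minH); apply/(mem_dual _ genG).
    by rewrite /laurent_mx map_trmx -map_mxM -row_mul AG row0 map_mx0.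
  have [x xE] := choice rowA; exists (\matrix_i x i).
  by apply/row_matrixP => i; rewrite row_mul rowK.
have [X XE] := memH _ _ E_orth; exists X.
have HG : H *m G^T = 0.
  apply: map_poly_laurent_inj; apply/row_matrixP => i.
  rewrite /laurent_mx map_mxM map_mx0 row_mul row0 -map_trmx.
  by apply/(mem_dual _ genG)/(mem_generator _ genH)/row_sub.
apply: (cancel_poly_free (generator_free genH)).
by rewrite mul1mx -mulmxA -XE E_proj.
Qed.
End Dual.

(** A homogeneous linear system with more unknowns than equations. It serves both the degree count
    for the dual and the construction of codewords with prescribed zeros. *)
Lemma common_zero (F : fieldType) a b (I : finType) (A : {pred I})
    (f : I -> 'M[F]_(a, b) -> F) :
    (forall i, scalar (f i)) -> (#|A| < a * b)%N ->
  exists2 v, v != 0 & forall i, i \in A -> f i v = 0.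
Proof.
move=> linf ltA; pose g (u : 'rV[F]_(a * b)) := \row_(t < #|A|) f (enum_val t) (vec_mx u).
have ling : linear g.
  by move=> c u v; apply/rowP => t; rewrite !mxE linearP linf.
pose gL : {linear 'rV_(a * b) -> 'rV_#|A|} :=
  HB.pack g (GRing.isLinear.Build _ _ _ _ g ling).
have: kermx (lin1_mx gL) != 0.
  by rewrite -mxrank_eq0 mxrank_ker -lt0n subn_gt0 (leq_ltn_trans (rank_leq_col _)).
case/rowV0Pn => u /sub_kermxP; rewrite mul_rV_lin1 => gu u0.
exists (vec_mx u) => [|i iA].
  by apply: contra u0 => /eqP vu; rewrite -(vec_mxK u) vu linear0.
have /rowP/(_ (enum_rank_in iA i)) := gu.
by rewrite !mxE enum_rankK_in.
Qed.

(** Parametrizes the polynomial vectors of degree below [d] by a matrix space, to which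
    [common_zero] applies. *)
Definition row_polys (F : fieldType) m d (v : 'M[F]_(m, d)) : 'rV[{poly F}]_m :=
  \row_i rVpoly (row i v).

Section RowPolys.
Variables (F : fieldType) (m d : nat).
Implicit Types u v : 'M[F]_(m, d).

Lemma row_polys_linear c u v :
  row_polys (c *: u + v) = c%:P *: row_polys u + row_polys v.
Proof. by apply/rowP => i; rewrite !mxE linearP /= linearP /= mul_polyC. Qed.

Lemma size_row_polys v i : (size (row_polys v 0%R i) <= d)%N.
Proof. by rewrite mxE size_poly. Qed.

Lemma row_polys_eq0 v : row_polys v = 0 -> v = 0.
Proof.
move=> /rowP v0; apply/row_matrixP => i; rewrite row0 -[LHS]rVpolyK.
by have := v0 i; rewrite !mxE => ->; rewrite linear0.
Qed.

Lemma coef_row_polysM_scalar n (G : 'M[{poly F}]_(m, n)) j t :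
  scalar (fun v => ((row_polys v *m G) 0 j)`_t : F).
Proof.
move=> c u v; rewrite row_polys_linear mulmxDl -scalemxAl.
move: (row_polys u *m _) (row_polys v *m _) => A B.
by rewrite !mxE coefD coefCM.
Qed.

End RowPolys.

(** * Degree comparison for orthogonal generator matrices *)

Section Degree.
Variables (F : fieldType) (n k k' : nat).

(** The orthogonal of [H] contains the row space of [G] and has the same dimension [k]. *)
Lemma mem_of_orthogonal (G : 'M[{poly F}]_(k, n)) C (H : 'M[{poly F}]_(k', n)) v :
    generator_matrix G C -> \rank (laurent_mx H) = k' -> (k + k' = n)%N ->
    laurent_mx G *m (laurent_mx H)^T = 0 -> v *m (laurent_mx H)^T = 0 ->
  C v.
Proof.
move=> genG rH kk GH vH; apply/(mem_generator _ genG).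
have sGK : (laurent_mx G <= kermx (laurent_mx H)^T)%MS by apply/sub_kermxP.
have rk : \rank (kermx (laurent_mx H)^T) = \rank (laurent_mx G).
  by rewrite mxrank_ker mxrank_tr rH; case: genG => -> _; rewrite -kk addnK.
have : (kermx (laurent_mx H)^T <= laurent_mx G)%MS.
  by rewrite -(mxrank_leqif_sup sGK) rk.
by apply: submx_trans; apply/sub_kermxP.
Qed.

Lemma row_degree_sum_orthogonal (G : 'M[{poly F}]_(k, n)) C
    (H : 'M[{poly F}]_(k', n)) :
    minimal_generator G C -> basic G -> \rank (laurent_mx H) = k' ->
    (k + k' = n)%N -> laurent_mx G *m (laurent_mx H)^T = 0 ->
  (row_degree_sum G <= row_degree_sum H)%N.
Proof.
move=> minG [R GR] rH kk GH; have [genG _] := minG.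
rewrite leqNgt; apply/negP => ltHG.
(* This [d] bounds every row degree of [G], so the subtractions from [d.+1] below do not
   truncate. *)
pose d := row_degree_sum G.
have degd i : (row_degree G i <= d)%N by rewrite /d /row_degree_sum (bigD1 i) //= leq_addr.
pose p (v : 'M[F]_(n, d.+1)) := row_polys v.
(* One condition for each coefficient of [p v *m H^T], and one for each coefficient of degree at
   most [d - row_degree G i] in entry [i] of [p v *m R], which will be [u]. If [H] had smaller
   degree than [G], these would be fewer than the [n * d.+1] unknowns. *)
pose I := ({l : 'I_k' & 'I_(d + row_degree H l).+1} +
           {i : 'I_k & 'I_(d.+1 - row_degree G i)})%type.
pose f (x : I) v := match x with
  | inl y => ((p v *m H^T) 0 (tag y))`_(tagged y)
  | inr y => ((p v *m R) 0 (tag y))`_(tagged y) end.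
have linf x : scalar (f x).
  by case: x => y; apply: coef_row_polysM_scalar.
have cardI : (#|{: I}| < n * d.+1)%N.
  rewrite card_sum !card_tagged !sumnE !big_map -!enumT !big_enum /=.
  under eq_bigr do rewrite card_ord.
  under [X in (_ + X)%N]eq_bigr do rewrite card_ord.
  rewrite -[X in (_ < X * _)%N]kk mulnDl [X in (_ < X)%N]addnC.
  have -> : (k' * d.+1 = \sum_(l < k') d.+1)%N by rewrite sum_nat_const card_ord.
  have sG : (\sum_(i < k) (d.+1 - row_degree G i) + row_degree_sum G = k * d.+1)%N.
    rewrite -big_split /= (eq_bigr (fun=> d.+1)) ?sum_nat_const ?card_ord // => i _.
    by rewrite subnK // leqW.
  have sH : (\sum_(l < k') (d + row_degree H l).+1 =
      \sum_(l < k') d.+1 + row_degree_sum H)%N.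
    by rewrite -big_split /=; apply: eq_bigr => l _; rewrite addSn.
  by rewrite sH -sG -addnA ltn_add2l addnC ltn_add2l.
have [v v0 fv] := common_zero linf cardI.
case/negP: v0; apply/eqP.
have pH : p v *m H^T = 0.
  apply/rowP => l; rewrite [RHS]mxE; apply/polyP => t; rewrite coef0.
  have [lt|ge] := ltnP t (d + row_degree H l).+1.
    exact: (fv (inl (Tagged (fun l => 'I_(d + row_degree H l).+1) (Ordinal lt))) isT).
  apply: nth_default; apply: leq_trans ge; rewrite mxE.
  apply: leq_trans (size_sum _ _ _) _; apply/bigmax_leqP => j _.
  have [->|pj] := eqVneq (p v 0 j) 0; first by rewrite mul0r size_poly0.
  apply: leq_trans (size_polyM_pred (m := row_degree H l) pj _) _.
    by rewrite mxE; exact: (leq_bigmax j).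
  by rewrite -addSn leq_add2r size_row_polys.
have Cp : C (laurent_mx (p v)).
  apply: (mem_of_orthogonal genG rH kk GH).
  by rewrite /laurent_mx map_trmx -map_mxM pH map_mx0.
have [u uE] := minimal_saturated minG Cp.
have uR : u = p v *m R by rewrite uE -mulmxA GR mulmx1.
(* The predictable degree property confines each entry of [u] to the coefficients already set to
   zero. *)
have u0 : u = 0.
  apply/rowP => i; rewrite [RHS]mxE; apply/eqP/negPn/negP => ui.
  have [j] := predictable_degree minG ui; rewrite -uE => hj.
  have {hj} : (size (u 0%R i) + row_degree G i <= d.+1)%N.
    by apply: leq_trans hj _; rewrite size_row_polys.
  move=> su.
  case/negP: ui; apply/eqP/polyP => t; rewrite coef0.
  have [lt|ge] := ltnP t (d.+1 - row_degree G i).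
    rewrite uR.
    exact: (fv (inr (Tagged (fun i => 'I_(d.+1 - row_degree G i)) (Ordinal lt))) isT).
  apply: nth_default; apply: leq_trans ge.
  by rewrite leq_subRL; [rewrite addnC|apply: leqW].
by apply: row_polys_eq0; rewrite -/(p v) uE u0 mul0mx.
Qed.

End Degree.

Lemma dual_conv_code (F : fieldType) n k delta (C : set 'rV[laurent F]_n) :
  conv_code k delta C -> conv_code (n - k) delta (dual_code C).
Proof.
move=> [k0 kn [G [minG basG degG]]]; have [genG _] := minG.
have [R GR] := basG.
have [H minH] := dual_minimal_ex genG GR; have [genH _] := minH.
have basH := dual_minimal_basic genG GR minH.
have HG : laurent_mx H *m (laurent_mx G)^T = 0.
  apply/row_matrixP => i; rewrite row_mul row0.
  by apply/(mem_dual _ genG)/(mem_generator _ genH)/row_sub.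
have GH : laurent_mx G *m (laurent_mx H)^T = 0.
  by apply: trmx_inj; rewrite trmx_mul trmxK HG trmx0.
have [rG _] := genG; have [rH _] := genH.
split; [lia..|exists H; split=> //].
rewrite -degG; apply/eqP; rewrite eqn_leq; apply/andP; split.
  by apply: (row_degree_sum_orthogonal minH basH rG); rewrite // subnK // ltnW.
by apply: (row_degree_sum_orthogonal minG basG rH); rewrite // subnKC // ltnW.
Qed.

(** * Distance profiles *)

Section Weights.
Variables (F : fieldType) (n : nat).
Implicit Types (v w x : 'rV[laurent F]_n).

Lemma weightE N (w : 'rV[F]_N) : weight w = (\sum_(i < N) (w 0%R i != 0%R))%N.
Proof.
by rewrite /weight -sum1_card big_mkcond; apply: eq_bigr => i _; rewrite inE; case: eqP.
Qed.

Lemma weight_mxvec a b (A : 'M[F]_(a, b)) :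
  weight (mxvec A) = (\sum_(i < a) weight (row i A))%N.
Proof.
rewrite weightE (reindex _ (curry_mxvec_bij _ _)) /=.
under [RHS]eq_bigr do rewrite weightE.
rewrite pair_big /=; apply: eq_bigr => -[i j] _ /=.
by rewrite mxvecE mxE.
Qed.

Lemma weight_window v j :
  weight (window v j) = (\sum_(0 <= t < j.+1) weight (vcoef v t%:Z))%N.
Proof.
rewrite weight_mxvec big_mkord; apply: eq_bigr => t _; congr weight.
by apply/rowP => c; rewrite !mxE.
Qed.

Lemma card_tail j i (Q : nat -> 'I_n -> bool) :
  #|[pred p : 'I_j.+1 * 'I_n | (i <= p.1)%N && Q p.1 p.2]| =
  (\sum_(i <= t < j.+1) #|[pred c | Q t c]|)%N.
Proof.
rewrite -sum1_card big_geq_mkord.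
rewrite -(pair_big_dep (fun t : 'I_j.+1 => (i <= t)%N) (fun t c => Q t c)
  (fun _ _ => 1%N)) /=.
by apply: eq_bigr => t _; rewrite sum1_card.
Qed.

Lemma card_ord_lt a : (a <= n)%N -> #|[pred c : 'I_n | (c < a)%N]| = a.
Proof.
by move=> an; rewrite -sum1_card (big_ord_narrow an) sum1_card card_ord.
Qed.

(** Among the positions at times [i] to [j], those in [U] are disjoint from the support of [x]. *)
Lemma weight_zeros x i j (U : {pred 'I_j.+1 * 'I_n}) :
    (forall p, p \in U -> x 0 p.2 (p.1 : nat)%:Z = 0) ->
  (#|[pred p in U | (i <= p.1)%N]| + \sum_(i <= t < j.+1) weight (vcoef x t%:Z)
    <= n * (j.+1 - i))%N.
Proof.
move=> xU.
have <- : #|[pred p : 'I_j.+1 * 'I_n | (i <= p.1)%N && (x 0 p.2 (p.1 : nat)%:Z != 0)]|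
    = (\sum_(i <= t < j.+1) weight (vcoef x t%:Z))%N.
  rewrite (card_tail _ _ (fun t c => x 0 c t%:Z != 0)).
  by apply: eq_bigr => t _; apply: eq_card => c; rewrite !inE mxE.
have <- : #|[pred p : 'I_j.+1 * 'I_n | (i <= p.1)%N && true]| = (n * (j.+1 - i))%N.
  by rewrite (card_tail _ _ (fun _ _ => true)) sum_nat_const_nat cardT size_enum_ord mulnC.
pose B := [pred p : 'I_j.+1 * 'I_n | x 0 p.2 (p.1 : nat)%:Z == 0].
rewrite -[X in (_ <= X)%N](cardID B) leq_add //.
  apply/subset_leq_card/fintype.subsetP => p; rewrite !inE => /andP[/xU -> ->].
  by rewrite eqxx.
by apply/subset_leq_card/fintype.subsetP => p; rewrite !inE => /andP[-> ->].
Qed.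

(** Multiplication by the inverse of D^i; codes are stable under it, so bounds for delay 0 also
    apply to words starting later. *)
Lemma delay_shift v (i : nat) : has_delay v i%:Z ->
  exists2 a : laurent F, has_delay (a *: v) 0 &
    forall t, vcoef (a *: v) t = vcoef v (t + i%:Z).
Proof.
move=> [vi vlt]; pose a := (poly_laurent ('X^i : {poly F}))^-1.
have X0 : poly_laurent ('X^i : {poly F}) != 0.
  rewrite -(rmorph0 (@poly_laurent F)) (inj_eq (@poly_laurent_inj F)).
  exact: monic_neq0 (monicXn _ _).
have sh t : vcoef (a *: v) t = vcoef v (t + i%:Z).
  apply/rowP => c; rewrite !mxE.
  have vE : v 0 c = poly_laurent 'X^i * (a * v 0 c) by rewrite mulrA divff ?mul1r.
  by rewrite [in RHS]vE coef_laurentXnM addrK.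
exists a => //; split=> [|t t0]; rewrite sh ?add0r //.
by apply: vlt; lia.
Qed.

Lemma weight_window_shift v w (i j : nat) : (i <= j)%N ->
    (forall t, vcoef w t = vcoef v (t + i%:Z)) ->
  weight (window w (j - i)) = (\sum_(i <= t < j.+1) weight (vcoef v t%:Z))%N.
Proof.
move=> ij wv; rewrite weight_window -{2}[i]add0n big_addn subSn //.
by apply: eq_bigr => t _; rewrite wv PoszD.
Qed.

Lemma lcoef_sum (I : finType) (f : I -> laurent F) j :
  (\sum_i f i) j = \sum_i f i j.
Proof. by apply: (big_morph (fun a : laurent F => a j)). Qed.

(** This is the coefficient of D^j in the product: [w], reversed in time, becomes a linear relation
    on the window of [v]. *)
Lemma coef_orthogonal v w (j : nat) :
    (forall t, t < 0 -> vcoef v t = 0) -> (forall t, t < 0 -> vcoef w t = 0) ->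
    w *m v^T = 0 ->
  \sum_(t < j.+1) \sum_c w 0 c (j - t)%N%:Z * v 0 c (t : nat)%:Z = 0.
Proof.
move=> v0 w0 /rowP/(_ 0); rewrite !mxE.
move=> /(congr1 (fun a : laurent F => a j%:Z)); rewrite lcoef_sum => sum0; rewrite -[RHS]sum0.
rewrite exchange_big; apply: eq_bigr => c _; rewrite mxE mulrC.
have vb : vanish_below 0 (v 0 c).
  by move=> t /v0/rowP/(_ c); rewrite !mxE.
have wb : vanish_below 0 (w 0 c).
  by move=> t /w0/rowP/(_ c); rewrite !mxE.
rewrite [RHS](convE (N := j.+1) vb wb); last by lia.
apply: eq_bigr => t _; rewrite mulrC add0r; congr (_ * w 0 c _).
by have := ltn_ord t; lia.
Qed.

End Weights.

Lemma set_extend (T : finType) (A : {set T}) m :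
  (#|A| <= m <= #|T|)%N -> exists2 U : {set T}, A \subset U & #|U| = m.
Proof.
elim: m => [|m IH] /andP[Am mT].
  by exists A => //; apply/eqP; rewrite -leqn0.
move: Am; rewrite leq_eqVlt => /orP[/eqP Am|Am]; first by exists A.
have [|U AU Um] := IH; first by rewrite -ltnS Am ltnW.
have [x xU] : exists x, x \notin U.
  apply/existsP; rewrite -negb_forall; apply/negP => /forallP all.
  have : #|T| = #|U| by apply: eq_card => x; rewrite all.
  by lia.
exists (x |: U)%SET; first by apply: fintype.subset_trans AU (finset.subsetU1 _ _).
by rewrite cardsU1 xU Um.
Qed.

Section ColumnDistance.
Variables (F : fieldType) (n : nat).
Implicit Types C : set 'rV[laurent F]_n.

(** The value is a successor because [nat_min] defaults to 0: only a nonzero value certifies that a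
    minimum exists. *)
Lemma column_distanceP C j m :
  column_distance C j = m.+1 <->
  (forall v, C v -> has_delay v 0 -> (m < weight (window v j))%N) /\
  exists v, [/\ C v, has_delay v 0 & weight (window v j) = m.+1].
Proof.
rewrite /column_distance /nat_min; set A := image _ _.
have memA v : C v -> has_delay v 0 -> A (weight (window v j)) by move=> Cv dv; exists v.
split=> [xE|[lb [v [Cv dv wv]]]]; last first.
  apply: xget_unique => [|p [[u [Cu du] <-] lbp]].
    by split=> [|p [u [Cu du] <-]]; [rewrite -wv; apply: memA|exact: lb].
  by apply/eqP; rewrite eqn_leq lb // andbT -wv; apply: lbp; apply: memA.
have [[p Sp]|noS] := pselect (exists p, A p /\ lbound A p); last first.
  by move: xE; rewrite xgetPN // => p Sp; apply: noS; exists p.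
have [] : A m.+1 /\ lbound A m.+1.
  by rewrite -xE; apply: (@xgetPex _ 0%N (fun q => A q /\ lbound A q)); exists p.
move=> [v [Cv dv] wv] lb.
split=> [u Cu du|]; first by apply: lb; apply: memA.
by exists v.
Qed.

End ColumnDistance.

(** * Transfer of weight bounds to the dual *)

Section Profile.
Variables (F : fieldType) (n k k' L : nat) (C : set 'rV[laurent F]_n).
Variables (G : 'M[{poly F}]_(k, n)).
Hypotheses (kk' : (k + k' = n)%N) (genG : generator_matrix G C) (basG : basic G).

Lemma generator_scale a v : C v -> C (a *: v).
Proof.
by rewrite !(mem_generator _ genG); apply: scalemx_sub.
Qed.

(** The inputs [u] of degree at most [j] have [k * j.+1] coefficients, more than the conditions
    imposed. The right inverse of [G] recovers [u] from its codeword, so a nonzero [u] gives a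
    codeword that starts by time [j]. *)
Lemma codeword_vanishing j (A : {pred 'I_j.+1 * 'I_n}) : (#|A| < k * j.+1)%N ->
  exists x (i : nat), [/\ C x, (i <= j)%N, has_delay x i%:Z &
    forall p, p \in A -> x 0 p.2 (p.1 : nat)%:Z = 0].
Proof.
move=> ltA; have [R GR] := basG.
pose f (p : 'I_j.+1 * 'I_n) (u : 'M[F]_(k, j.+1)) := ((row_polys u *m G) 0 p.2)`_p.1.
have [u u0 fu] := common_zero (fun p => coef_row_polysM_scalar G p.2 p.1 : scalar (f p)) ltA.
set y := row_polys u *m G.
pose P t := vcoef (laurent_mx y) t%:Z != 0.
have exP : exists t, (t <= j)%N && P t.
  apply: contrapT => /forallNP no; case/negP: u0; apply/eqP/row_polys_eq0.
  have yR : row_polys u = y *m R by rewrite -mulmxA GR mulmx1.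
  apply/rowP => l; rewrite [RHS]mxE; apply/polyP => t; rewrite coef0.
  have [tj|tj] := leqP t j; last first.
    by apply: nth_default; apply: leq_trans tj; apply: size_row_polys.
  rewrite yR mxE coef_sum big1 // => c _; rewrite coefM big1 // => s _.
  have sj : (s <= j)%N by rewrite (leq_trans _ tj) // -ltnS.
  have /negP := no s; rewrite sj /= negbK => /eqP/rowP/(_ c).
  by rewrite !mxE /= => ->; rewrite mul0r.
case: (ex_minnP exP) => i /andP[ij Pi] imin.
exists (laurent_mx y), i; split=> //.
- by apply/(mem_generator _ genG); rewrite /y /laurent_mx map_mxM submxMl.
- split=> // -[t|t] ti; last by apply/rowP => c; rewrite !mxE.
  apply/eqP/negPn/negP => Pt; have : (i <= t)%N.
    by apply: imin; apply/andP; split; [lia|exact: Pt].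
  by lia.
- by move=> p /fu yp; rewrite mxE; exact: yp.
Qed.

Hypothesis bound : forall i, (i <= L)%N -> forall v, C v -> has_delay v 0 ->
  (k' * i.+1 < weight (window v i))%N.

(** Shifted to delay 0, [x] has weight above [k' * (j - i).+1] among the [n * (j - i).+1] positions
    from time [i] on. *)
Lemma zeros_tail j (i : nat) x (U : {pred 'I_j.+1 * 'I_n}) :
    (i <= j)%N -> (j <= L)%N -> C x -> has_delay x i%:Z ->
    (forall p, p \in U -> x 0 p.2 (p.1 : nat)%:Z = 0) ->
  (#|[pred p in U | (i <= p.1)%N]| < k * (j - i).+1)%N.
Proof.
move=> ij jL Cx dx xU.
have [a da sh] := delay_shift dx.
have := weight_zeros i xU; rewrite -(weight_window_shift ij sh) subSn //.
have -> : (n * (j - i).+1 = k * (j - i).+1 + k' * (j - i).+1)%N.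
  by rewrite -mulnDl kk'.
have : (j - i <= L)%N by lia.
by move=> /bound/(_ _ (generator_scale a Cx) da); lia.
Qed.

(* Prescribing as many zeros as the dimension allows, one fewer in the first
   block, forces delay 0.                                                     *)
Lemma bound_attained j : (0 < k)%N -> (j <= L)%N ->
  exists v, [/\ C v, has_delay v 0 & weight (window v j) = (k' * j.+1).+1].
Proof.
move=> k0 jL.
pose Q (t : nat) (c : 'I_n) := (c < k - (t == 0%N))%N.
pose A := [pred p : 'I_j.+1 * 'I_n | Q p.1 p.2].
have cardQ t : #|[pred c | Q t c]| = (k - (t == 0%N))%N.
  by apply: card_ord_lt; lia.
have tailA i : #|[pred p in A | (i <= p.1)%N]| =
    (\sum_(i <= t < j.+1) (k - (t == 0%N)))%N.
  rewrite (eq_bigr _ (fun t _ => esym (cardQ t))) -card_tail.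
  by apply: eq_card => p; rewrite !inE andbC.
have cardA : (#|A|.+1 = k * j.+1)%N.
  have -> : #|A| = #|[pred p in A | (0 <= p.1)%N]|.
    by apply: eq_card => p; rewrite !inE andbT.
  rewrite tailA big_nat_recl // (eq_bigr (fun=> k)) => [|t _]; last by rewrite subn0.
  by rewrite sum_nat_const_nat; lia.
have [|x [i [Cx ij dx xA]]] := @codeword_vanishing j A; first by rewrite cardA.
have := zeros_tail ij jL Cx dx xA.
(* A later start would leave [k] zeros at each time from [i] to [j], one more in total than
   [zeros_tail] allows. *)
case: (posnP i) => [i0 _|i0]; last first.
  rewrite tailA (eq_big_nat _ _ (F2 := fun=> k)) => [|t]; last by lia.
  by rewrite sum_nat_const_nat subSn // mulnC ltnn.
rewrite i0 in dx; exists x; split=> //; apply/eqP.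
rewrite eqn_leq bound // andbT weight_window.
have := weight_zeros 0 xA; rewrite subn0.
have -> : (n * j.+1 = #|A|.+1 + k' * j.+1)%N by rewrite cardA -mulnDl kk'.
have -> : #|[pred p in A | (0 <= p.1)%N]| = #|A|.
  by apply: eq_card => p; rewrite !inE andbT.
by lia.
Qed.

Lemma dual_bound (C' : set 'rV[laurent F]_n) :
    (forall v w, C v -> C' w -> w *m v^T = 0) ->
  forall j, (j <= L)%N -> forall w, C' w -> has_delay w 0 ->
  (k * j.+1 < weight (window w j))%N.
Proof.
move=> orth; elim/ltn_ind => j IH jL w C'w dw.
rewrite ltnNge; apply/negP => light.
(* The support of [w] reversed in time: times [i] to [j] of [T] match times 0 to [j - i] of [w]. *)
pose Q t c := w 0 c (j - t)%N%:Z != 0.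
pose T : {set 'I_j.+1 * 'I_n} := [set p : 'I_j.+1 * 'I_n | Q p.1 p.2]%SET.
have tailT i : (i <= j)%N ->
    #|[pred p in T | (i <= p.1)%N]| = weight (window w (j - i)).
  move=> ij; rewrite weight_window.
  transitivity #|[pred p : 'I_j.+1 * 'I_n | (i <= p.1)%N && Q p.1 p.2]|.
    by apply: eq_card => p; rewrite !inE andbC.
  rewrite card_tail -{1}[i]add0n big_addn subSn // [RHS]big_nat_rev /=.
  apply: eq_big_nat => t tj; apply: eq_card => c; rewrite !inE mxE /Q.
  by congr (w 0 c _ != 0); lia.
have cardT : #|T| = weight (window w j).
  rewrite -[j in RHS]subn0 -tailT //.
  by apply: eq_card => p; rewrite !inE andbT.
have [c0 wc0] : exists c, w 0 c 0 != 0.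
  apply: contrapT => /forallNP no; case: dw => /eqP[]; apply/rowP => c.
  by rewrite !mxE; apply/eqP/negPn/negP/no.
(* The last time corresponds under reversal to time 0 of [w], where delay 0 supplies a nonzero
   coordinate. *)
pose e : 'I_j.+1 * 'I_n := (ord_max, c0).
have eT : e \in T by rewrite inE /Q /= subnn.
have [|U TU cardU] := @set_extend _ T (k * j.+1)%N.
  by rewrite cardT light card_prod !card_ord mulnC leq_mul2l -kk' leq_addr orbT.
have eU : e \in U by apply: (fintype.subsetP TU).
have [|x [i [Cx ij dx xA]]] := @codeword_vanishing j (mem (U :\ e)%SET).
  by rewrite -cardU (cardsD1 e U) eU add1n.
(* In the orthogonality relation every other term vanishes: [x] is zero on the rest of [T], and the
   coefficient from [w] is zero off [T]. *)
have xe : x 0 c0 j%:Z = 0.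
  have x0 t : t < 0 -> vcoef x t = 0 by move=> t0; apply: (proj2 dx); lia.
  have := coef_orthogonal j x0 (proj2 dw) (orth _ _ Cx C'w).
  rewrite pair_big (bigD1 e) //= subnn big1 ?addr0 => [/eqP|p pe].
    by rewrite mulf_eq0 (negPf wc0) => /eqP.
  have [pT|] := boolP (p \in T); last by rewrite inE negbK => /eqP ->; rewrite mul0r.
  by rewrite xA ?mulr0 // !inE pe (fintype.subsetP TU).
have xU p : p \in mem U -> x 0 p.2 (p.1 : nat)%:Z = 0.
  by move=> pU; have [->//|pe] := eqVneq p e; apply: xA; rewrite !inE pe.
have := zeros_tail ij jL Cx dx xU; rewrite ltnNge => /negP; apply.
(* For [i = 0] all of [U] consists of zeros. Otherwise the induction hypothesis at [j - i] makes the
   part of [T] from time [i] on, which lies in [U], large enough. *)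
case: (posnP i) => [->|i0].
  by rewrite subn0 -cardU subset_leq_card //; apply/fintype.subsetP => p pU; rewrite !inE pU.
have /ltnW lt : (k * (j - i).+1 < weight (window w (j - i)))%N by apply: IH => //; lia.
apply: leq_trans lt _; rewrite -tailT // subset_leq_card //.
apply/fintype.subsetP => p; rewrite !inE => /andP[pT ->]; rewrite andbT.
by apply: (fintype.subsetP TU); rewrite inE.
Qed.

End Profile.

(** [dual_bound] carries the lower bound from [C] to [C']; [bound_attained], applied to [C'] with
    [k] and [k'] exchanged, turns it into an equality. *)
Lemma column_distance_dual (F : fieldType) n k k' L (C C' : set 'rV[laurent F]_n)
    (G : 'M[{poly F}]_(k, n)) (G' : 'M[{poly F}]_(k', n)) :
    (k + k' = n)%N -> (0 < k')%N ->
    generator_matrix G C -> basic G -> generator_matrix G' C' -> basic G' ->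
    (forall v w, C v -> C' w -> w *m v^T = 0) ->
    (forall j, (j <= L)%N -> column_distance C j = (k' * j.+1 + 1)%N) ->
  forall j, (j <= L)%N -> column_distance C' j = (k * j.+1 + 1)%N.
Proof.
move=> kk k'0 genG basG genG' basG' orth mdp.
have bound i : (i <= L)%N -> forall v, C v -> has_delay v 0 ->
    (k' * i.+1 < weight (window v i))%N.
  by move=> /mdp; rewrite addn1 => /column_distanceP[].
have bound' := dual_bound kk genG basG bound orth.
move=> j jL; rewrite addn1; apply/column_distanceP; split; first exact: bound'.
by apply: (bound_attained _ genG' basG' bound') => //; rewrite addnC.
Qed.

Theorem theorem5p4 (F : finFieldType) (n k delta : nat)
    (C : set 'rV[laurent F]_n) (hC : conv_code k delta C) :
  max_distance_profile k delta C <->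
  max_distance_profile (n - k) delta (dual_code C).
Proof.
have hC' := dual_conv_code hC.
have [k0 kn [G [[genG _] basG _]]] := hC.
have [k'0 _ [G' [[genG' _] basG' _]]] := hC'.
have kk : (n - (n - k) = k)%N by rewrite subKn // ltnW.
have kk1 : (k + (n - k) = n)%N by rewrite subnKC // ltnW.
have kk2 : (n - k + k = n)%N by rewrite subnK // ltnW.
have orth v w : C v -> dual_code C w -> w *m v^T = 0 by move=> Cv; apply.
have orth' w v : dual_code C w -> C v -> v *m w^T = 0.
  by move=> dw Cv; apply: trmx_inj; rewrite trmx_mul trmxK (orth v) ?trmx0.
split=> -[_ mdp]; split=> //.
  rewrite kk addnC.
  exact: (column_distance_dual kk1 k'0 genG basG genG' basG' orth mdp).
rewrite kk addnC in mdp.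
exact: (column_distance_dual kk2 k0 genG' basG' genG basG orth' mdp).
Qed.
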